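(* Let $X$ be a real Hilbert space, let $B\colon X\rightrightarrows X$ be maximally $\beta$-monotone with $\beta\ge0$, and let $C\colon X\to X$ be $\sigma$-cocoercive. Let $\gamma\in\,]0,4\sigma[$, $\eta\in\,]0,2-\frac\gamma{2\sigma}[$, and $T_{\rm FB}:=(1-\eta)\mathrm{Id}+\eta J_{\gamma B}(\mathrm{Id}-\gamma C)$. Let $x_0\in X$ and $x_{n+1}:=T_{\rm FB}x_n$. Then: (i) For all $x,y\in X$, $$\|T_{\rm FB}x-T_{\rm FB}y\|^2\le\|x-y\|^2-\Big(\frac{4\sigma-\gamma}{2\eta\sigma}-1\Big)\|(\mathrm{Id}-T_{\rm FB})x-(\mathrm{Id}-T_{\rm FB})y\|^2-\frac{\gamma}{2\eta\sigma}\|(\mathrm{Id}-T_{\rm FB})x-(\mathrm{Id}-T_{\rm FB})y-2\eta\sigma(Cx-Cy)\|^2;$$ in particular $T_{\rm FB}$ is $\frac{2\eta\sigma}{4\sigma-\gamma}$-averaged. (ii) If $\operatorname{zer}(B+C)\neq\varnothing$, then $\|x_n-T_{\rm FB}x_n\|=o(1/\sqrt n)$, $(x_n)$ converges weakly to some $x^*\in\operatorname{zer}(B+C)$, $(Cx_n)$ converges strongly to $Cx^*$, and $C(\operatorname{zer}(B+C))=\{Cx^*\}$. If additionally $\beta>0$, then $(x_n)$ converges strongly to $x^*$ and $\operatorname{zer}(B+C)=\{x^*\}$.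
   Context: $J_B:=(\mathrm{Id}+B)^{-1}$; $\operatorname{zer}B:=\{x:0\in Bx\}$. $B$ is maximally $\beta$-monotone if $\langle x-y,u-v\rangle\ge\beta\|x-y\|^2$ for all $(x,u),(y,v)\in\operatorname{gra}B$ and no operator with this property has a graph properly containing $\operatorname{gra}B$. $C$ is $\sigma$-cocoercive if $\langle x-y,Cx-Cy\rangle\ge\sigma\|Cx-Cy\|^2$. $T$ is $\theta$-averaged ($\theta\in(0,1)$) if $T=(1-\theta)\mathrm{Id}+\theta N$ with $N$ nonexpansive. *)

(* Defs.v *)
From HB Require Import structures.
From mathcomp Require Import all_boot all_order all_algebra.
From mathcomp Require Import all_classical all_reals all_analysis.
Set Implicit Arguments. Unset Strict Implicit. Unset Printing Implicit Defensive.
Import Order.TTheory GRing.Theory Num.Theory.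
Import numFieldNormedType.Exports.
Local Open Scope classical_set_scope.
Local Open Scope ring_scope.

Section Defs.
Variables (R : realType) (X : completeNormedModType R).

(* A real Hilbert space: a complete normed space whose norm is induced by an
   inner product ip (symmetric, linear in the first argument, <x,x> = |x|^2). *)
Definition inner_product (ip : X -> X -> R) : Prop :=
  (forall x y, ip x y = ip y x) /\
  (forall a x y z, ip (a *: x + y) z = a * ip x z + ip y z) /\
  (forall x, ip x x = `|x| ^+ 2).

Definition beta_monotone (ip : X -> X -> R) (beta : R) (A : X -> set X) : Prop :=
  forall x u y v, A x u -> A y v -> beta * `|x - y| ^+ 2 <= ip (x - y) (u - v).

Definition max_beta_monotone (ip : X -> X -> R) (beta : R) (A : X -> set X) : Prop :=
  beta_monotone ip beta A /\
  forall A' : X -> set X, beta_monotone ip beta A' ->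
    (forall x u, A x u -> A' x u) -> (forall x u, A' x u -> A x u).

Definition cocoercive (ip : X -> X -> R) (sigma : R) (C : X -> X) : Prop :=
  forall x y, sigma * `|C x - C y| ^+ 2 <= ip (x - y) (C x - C y).

Definition nonexpansive (N : X -> X) : Prop :=
  forall x y, `|N x - N y| <= `|x - y|.

Definition averaged (theta : R) (T : X -> X) : Prop :=
  0 < theta < 1 /\
  exists N : X -> X, nonexpansive N /\
    forall x, T x = (1 - theta) *: x + theta *: N x.

Definition scale_op (g : R) (A : X -> set X) : X -> set X :=
  fun x => [set g *: u | u in A x].

Definition add_op (A : X -> set X) (C : X -> X) : X -> set X :=
  fun x => [set u + C x | u in A x].

Definition zer (A : X -> set X) : set X := [set x | A x 0].

(* resolvent J_A = (Id + A)^{-1}: J_A x is a point p with x \in p + A p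
   (chosen by classical choice; single-valued and total when A is maximally
   monotone, by Minty's theorem). *)
Definition resolvent (A : X -> set X) (x : X) : X :=
  xget 0 [set p | A p (x - p)].

Definition T_FB (eta gamma : R) (B : X -> set X) (C : X -> X) (x : X) : X :=
  (1 - eta) *: x + eta *: resolvent (scale_op gamma B) (x - gamma *: C x).

Definition weak_cvg (ip : X -> X -> R) (u : nat -> X) (l : X) : Prop :=
  forall y, (fun n => ip (u n) y) @ \oo --> ip l y.

End Defs.

(* Main.v *)
(* With J the resolvent of gamma B, monotonicity of B at the two points J x, J y
   plus gamma times the cocoercivity inequality of C is, after multiplication by
   2 eta, exactly the inequality of (i) (with an extra term
   - 2 eta gamma beta |J x - J y|^2).  Taking y in zer (B + C) = Fix T, the
   squared distances |x_n - y|^2 decrease by three nonnegative terms, so each of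
   these is summable: this gives the rate of the residuals, C x_n -> C y and,
   when beta > 0, x_n -> y.  Weak convergence is Opial's argument, run along
   ultrafilters of indices, for which weak limits of bounded sequences exist by
   the Riesz representation theorem.  That J is everywhere defined is Minty's
   theorem, and both Riesz and Minty follow from the fact that minimizing
   sequences of strongly convex functions are Cauchy. *)
Require Import Defs.
From HB Require Import structures.
From mathcomp Require Import all_boot all_order all_algebra.
From mathcomp Require Import all_classical all_reals all_analysis.
From mathcomp Require Import ring lra.
Set Implicit Arguments. Unset Strict Implicit. Unset Printing Implicit Defensive.
Import Order.TTheory GRing.Theory Num.Theory.
Import numFieldNormedType.Exports.
Local Open Scope classical_set_scope.
Local Open Scope ring_scope.

(** * Real sequences and minimizing sequences *)

(** Yields first-order conditions at a minimizer: [P] is the slope along a segment and [s * Q] the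
    quadratic term, both after division by [s]. *)
Lemma ge0_linear_at0 (R : realFieldType) (P Q : R) :
  (forall s, 0 < s <= 1 -> 0 <= P + s * Q) -> 0 <= P.
Proof.
move=> H; rewrite leNgt; apply/negP => P0.
have Q0 : 0 <= `|Q| by [].
have QQ : Q <= `|Q| by exact: ler_norm.
have D0 : 0 < 2 * (`|Q| + 1 - P) by lra.
(* This choice gives [s * |Q| <= - P / 2], hence [P + s * Q <= P / 2 < 0]. *)
pose s := - P / (2 * (`|Q| + 1 - P)).
have s0 : 0 < s by rewrite divr_gt0 // oppr_gt0.
have sE : s * (2 * (`|Q| + 1 - P)) = - P by rewrite /s divfK // gt_eqF.
have s1 : s <= 1 by rewrite /s ler_pdivrMr //; lra.
have := H s; rewrite s0 s1 => /(_ isT).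
nra.
Qed.

Lemma minimizing_seq (R : realType) (T : Type) (S : set T) (g : T -> R) (b : R) :
  S !=set0 -> (forall z, S z -> b <= g z) ->
  exists (m : R) (u : nat -> T), (forall z, S z -> m <= g z) /\
    (forall k, S (u k) /\ g (u k) <= m + k.+1%:R^-1).
Proof.
move=> [z0 Sz0] gb.
have hasinf : has_inf (g @` S).
  by split; [exists (g z0); exists z0 | exists b => _ [z Sz <-]; exact: gb].
exists (inf (g @` S)).
have /choice [u uP] k : exists z, S z /\ g z <= inf (g @` S) + k.+1%:R^-1.
  have [|_ [z Sz <-] /ltW] := @inf_adherent _ (g @` S) (k.+1%:R^-1) _ hasinf.
    by rewrite invr_gt0.
  by exists z.
exists u; split=> // z Sz; apply: ge_inf; first by case: hasinf.
by exists z.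
Qed.

Lemma cvg0_of_sqr (R : realType) (V : normedModType R) (T : Type)
    (F : set_system T) (FF : Filter F) (v : T -> V) :
  (fun t => `|v t| ^+ 2) @ F --> (0 : R) -> v @ F --> 0.
Proof.
move=> v2; apply/cvgr0Pnorm_lt => e e0.
have /cvgr0Pnorm_lt /(_ (e ^+ 2)) := v2; rewrite exprn_gt0 // => /(_ isT).
apply: filterS => t; rewrite ger0_norm ?sqr_ge0 //.
by rewrite ltr_pXn2r ?nnegrE // ltW.
Qed.

Lemma cvg0_of_telescope (R : realType) (f a : nat -> R) (c : R) :
  0 < c -> (forall n, 0 <= a n) -> cvg (f @ \oo) ->
  (forall n, f n.+1 <= f n - c * a n) -> a @ \oo --> 0.
Proof.
move=> c0 a0 /cvg_ex[/= l fl] fa.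
apply: (@squeeze_cvgr _ _ _ _ (fun=> 0) (fun n => c^-1 * (f n - f n.+1))).
- apply: nearW => n; rewrite a0 /= ler_pdivlMl //.
  by have := fa n; lra.
- exact: cvg_cst.
- rewrite -(mulr0 c^-1) -(subrr l); apply: cvgM; first exact: cvg_cst.
  by apply: cvgB => //; rewrite (cvg_shiftS f).
Qed.

(* For m <= n, (n - m) a_n is at most the sum of a_m, ..., a_(n-1), which is a
   tail of a convergent series. *)
Lemma cvg0_natmul (R : realType) (f a : nat -> R) (c : R) :
  0 < c -> (forall n, 0 <= a n) -> (forall n, a n.+1 <= a n) -> cvg (f @ \oo) ->
  (forall n, f n.+1 <= f n - c * a n) -> (fun n => n%:R * a n) @ \oo --> 0.
Proof.
move=> c0 a0 a_dec /cvg_ex[/= l fl] fa.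
have a_dec2 m k : a (m + k)%N <= a m.
  by elim: k => [|k IH]; rewrite ?addn0 // addnS (le_trans (a_dec _)).
have f_drop m k : f (m + k)%N + c * k%:R * a (m + k)%N <= f m.
  elim: k => [|k IH]; first by rewrite addn0 mulr0 mul0r addr0.
  apply: le_trans IH; rewrite addnS -[k.+1%:R]natr1.
  have := fa (m + k)%N; have := a_dec (m + k)%N.
  have : 0 <= c * k%:R by rewrite mulr_ge0 // ltW.
  have := a0 (m + k).+1; nra.
have l_le m : l <= f m.
  apply: (ler_cvg_to fl (cvg_cst (f m))); exists m => // n /= mn.
  have := f_drop m (n - m)%N; rewrite subnKC // => H.
  by apply: le_trans H; rewrite lerDl !mulr_ge0 // ltW.
apply/cvgr0Pnorm_lt => e e0.
have d0 : 0 < c * e / 2 by rewrite divr_gt0 // mulr_gt0.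
have [m _ mP] : \forall m \near \oo, `|l - f m| < c * e / 2.
  by have /cvgr_dist_lt := fl; exact.
(* For [n >= 2m] one has [n <= 2(n - m)], so [c n a_n <= 2(f m - f n) <= 2(f m - l) < c e]. *)
exists (2 * m)%N => // n /= mn.
rewrite ger0_norm ?mulr_ge0 // -(ltr_pM2l c0).
have {}mP : f m - l < c * e / 2.
  by have := mP m (leqnn m); rewrite distrC; apply: le_lt_trans; exact: ler_norm.
have mn' : (m <= n)%N by rewrite (leq_trans _ mn) // leq_pmull.
have := f_drop m (n - m)%N; rewrite subnKC // natrB //.
have : (2 * m)%:R <= n%:R :> R by rewrite ler_nat.
rewrite natrM; have := l_le n; have := a0 n; move: mP.
have : 0 <= m%:R :> R by [].
move=> M0 mP an ln mn2.
have : 0 <= c * a n * (n%:R - 2 * m%:R) by rewrite !mulr_ge0 ?(ltW c0) // subr_ge0.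
lra.
Qed.

(** * Hilbert spaces: Minty, Riesz, Opial *)

Section InnerProduct.
Variables (R : realType) (X : completeNormedModType R) (ip : X -> X -> R).
Variable ip_inner : inner_product ip.

Lemma ipC x y : ip x y = ip y x. Proof. by case: ip_inner. Qed.
Lemma sqr_norm x : `|x| ^+ 2 = ip x x. Proof. by case: ip_inner => _ []. Qed.

Lemma ipDl x y z : ip (x + y) z = ip x z + ip y z.
Proof. by have [_ [+ _]] := ip_inner => /(_ 1 x y z); rewrite scale1r mul1r. Qed.

Lemma ip0l z : ip 0 z = 0.
Proof. by apply: (@addrI _ (ip 0 z)); rewrite -ipDl !addr0. Qed.

Lemma ipZl a x z : ip (a *: x) z = a * ip x z.
Proof. by have [_ [+ _]] := ip_inner => /(_ a x 0 z); rewrite ip0l !addr0. Qed.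

Lemma ipNl x z : ip (- x) z = - ip x z.
Proof. by rewrite -scaleN1r ipZl mulN1r. Qed.

Lemma ipDr x y z : ip z (x + y) = ip z x + ip z y.
Proof. by rewrite ipC ipDl !(ipC z). Qed.

Lemma ipZr a x z : ip z (a *: x) = a * ip z x.
Proof. by rewrite ipC ipZl ipC. Qed.

Lemma ipNr x z : ip z (- x) = - ip z x.
Proof. by rewrite ipC ipNl ipC. Qed.

Definition ipE := (ipDl, ipDr, ipNl, ipNr, ipZl, ipZr).

Lemma ip_ge0 x : 0 <= ip x x.
Proof. by rewrite -sqr_norm sqr_ge0. Qed.

Lemma ip_le0_eq0 x : ip x x <= 0 -> x = 0.
Proof.
rewrite -sqr_norm => H; apply/eqP; rewrite -normr_eq0 -sqrf_eq0.
by rewrite eq_le H sqr_ge0.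
Qed.

(** Cauchy-Schwarz, read off from the triangle inequality of the given norm by expanding squares. *)
Lemma ip_le_norm x y : `|ip x y| <= `|x| * `|y|.
Proof.
have H u v : ip u v <= `|u| * `|v|.
  have : `|u + v| ^+ 2 <= (`|u| + `|v|) ^+ 2.
    by rewrite lerXn2r ?nnegrE ?addr_ge0 ?ler_normD.
  rewrite sqrrD !sqr_norm !ipE (ipC v u); lra.
by rewrite ler_norml H andbT lerNl -ipNl (le_trans (H _ _)) ?normrN.
Qed.

(** Polarization reduces this to continuity of the norm. *)
Lemma cvg_ip {T : Type} {F : set_system T} {FF : Filter F} (f g : T -> X) (l m : X) :
  f @ F --> l -> g @ F --> m -> (fun t => ip (f t) (g t)) @ F --> ip l m.
Proof.
move=> fl gm.
have polar x y : ip x y = (`|x + y| * `|x + y| - `|x - y| * `|x - y|) * 4^-1.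
  by rewrite -!expr2 !sqr_norm !ipE (ipC y x); field.
rewrite polar; under eq_fun do rewrite polar.
apply: cvgM; last exact: cvg_cst.
have fDg : (fun t => f t + g t) @ F --> l + m by exact: cvgD.
have fBg : (fun t => f t - g t) @ F --> l - m by exact: cvgB.
by apply: cvgB; apply: cvgM; exact: cvg_norm.
Qed.

(** The hypothesis is what the parallelogram identity gives at the midpoint of two points that
    minimize up to [1/(i+1)] and [1/(j+1)]. *)
Lemma cvg_minimizing (u : nat -> X) (K : R) :
  (forall i j, `|u i - u j| ^+ 2 <= K * (i.+1%:R^-1 + j.+1%:R^-1)) ->
  cvg (u @ \oo).
Proof.
move=> uK; apply/cauchy_cvgP/cauchy_exP => e e0.
pose K' := `|K| + 1.
have K'0 : 0 < K' by rewrite ltr_wpDl.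
have d0 : 0 < e ^+ 2 / (2 * K') by rewrite divr_gt0 ?exprn_gt0 ?mulr_gt0.
have [N _ NP] := near_infty_natSinv_lt (PosNum d0).
exists (u N); exists N => // i /= Ni; rewrite /= -ball_normE /=.
rewrite -(@ltr_pXn2r _ 2) ?nnegrE //; last exact: ltW.
have := NP N (leqnn N); have := NP i Ni => /=.
rewrite !ltr_pdivlMr ?mulr_gt0 //.
set a := i.+1%:R^-1; set b := N.+1%:R^-1 => ai bi.
apply: (le_lt_trans (uK N i)).
have a0 : 0 <= a by rewrite invr_ge0.
have b0 : 0 <= b by rewrite invr_ge0.
have KK : K <= K' by rewrite /K' (le_trans (ler_norm K)) ?lerDl.
rewrite -/a -/b; nra.
Qed.

(* Simons' proof of Minty's theorem: the Fitzpatrick function of [A] plus half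
   the squared norm of [X * X] is strongly convex, hence attains its infimum;
   the optimality condition at the minimizer [(x, u)] says that [(-u, -x)] is
   monotonically related to [A].  Points of the epigraph of the Fitzpatrick
   function are used instead of its values, which may be infinite. *)
Lemma minty (A : X -> set X) :
  (forall x u y v, A x u -> A y v -> 0 <= ip (x - y) (u - v)) ->
  (forall x u, (forall a b, A a b -> 0 <= ip (x - a) (u - b)) -> A x u) ->
  exists x, A x (- x).
Proof.
move=> mon maxi.
have [a0 [b0 A0]] : exists a b, A a b.
  (* Were the graph empty, [(0, 0)] would be vacuously related to it and so belong to [A]. *)
  apply: contrapT => H; apply: (H); exists 0, 0; apply: maxi => a b Aab.
  by exfalso; apply: H; exists a, b.
pose S : set (X * X * R) := [set z | forall a b, A a b ->
  ip z.1.1 b + ip a z.1.2 - ip a b <= z.2].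
pose g (z : X * X * R) := z.2 + (ip z.1.1 z.1.1 + ip z.1.2 z.1.2) / 2.
have S_graph a b : A a b -> S (a, b, ip a b).
  move=> Aab c d Acd /=; have := mon _ _ _ _ Aab Acd; rewrite !ipE; lra.
(* If [t < <x, u>], membership in [S] makes [(x, u)] monotonically related to [A], hence a point of
   [A]; testing [S] at that point gives [<x, u> <= t]. *)
have S_ge_ip z : S z -> ip z.1.1 z.1.2 <= z.2.
  case: z => [[x u] t] /= Sz; rewrite leNgt; apply/negP => tlt.
  have /Sz /= : A x u.
    by apply: maxi => a b Aab; have /= := Sz _ _ Aab; rewrite !ipE; lra.
  lra.
have g_ge0 z : S z -> 0 <= g z.
  move=> /S_ge_ip; case: z => [[x u] t] /=; rewrite /g /= => xut.
  by have := ip_ge0 (x + u); rewrite !ipE (ipC u x); lra.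
have [m [z [gm zm]]] := minimizing_seq (ex_intro _ _ (S_graph _ _ A0)) g_ge0.
pose x k := (z k).1.1; pose u k := (z k).1.2; pose t k := (z k).2.
have S_conv z1 z2 (s : R) : S z1 -> S z2 -> 0 <= s <= 1 ->
    S (z1.1.1 + s *: (z2.1.1 - z1.1.1), z1.1.2 + s *: (z2.1.2 - z1.1.2),
       z1.2 + s * (z2.2 - z1.2)).
  case: z1 => [[x1 u1] t1]; case: z2 => [[x2 u2] t2] S1 S2 /andP[s0 s1] a b Aab.
  by have := S1 _ _ Aab; have := S2 _ _ Aab; rewrite /= !ipE; nra.
have half : 0 <= (2^-1 : R) <= 1
  by rewrite invr_ge0 ler0n invf_le1 ?ler1n.
have cauchy i j : ip (x i - x j) (x i - x j) + ip (u i - u j) (u i - u j) <=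
    4 * (i.+1%:R^-1 + j.+1%:R^-1).
  have [Si gi] := zm i; have [Sj gj] := zm j.
  have /gm := S_conv _ _ _ Si Sj half.
  move: gi gj; rewrite /g /= -/(x i) -/(x j) -/(u i) -/(u j) -/(t i) -/(t j).
  rewrite !ipE (ipC (x j) (x i)) (ipC (u j) (u i)).
  move: (i.+1%:R^-1) (j.+1%:R^-1) => di dj; lra.
have /cvg_ex [/= xl xP] : cvg (x @ \oo).
  apply: (@cvg_minimizing _ 4) => i j; apply: le_trans (cauchy i j).
  by rewrite sqr_norm lerDl ip_ge0.
have /cvg_ex [/= ul uP] : cvg (u @ \oo).
  apply: (@cvg_minimizing _ 4) => i j; apply: le_trans (cauchy i j).
  by rewrite sqr_norm lerDr ip_ge0.
(* Move an almost minimizer a fraction [s] towards [(a, b, <a, b>)]; [S_ge_ip] replaces [t k] by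
   [<x k, u k>], whose limit is available. *)
have opt a b : A a b ->
    0 <= ip a b - ip xl ul + (ip xl (a - xl) + ip ul (b - ul)).
  move=> Aab; apply: (@ge0_linear_at0 _ _
    ((ip (a - xl) (a - xl) + ip (b - ul) (b - ul)) / 2)) => s /andP[s0 s1].
  rewrite -(pmulr_rge0 _ s0).
  pose psi x' u' := s * (ip a b - ip x' u' + (ip x' (a - x') + ip u' (b - u'))
    + s * ((ip (a - x') (a - x') + ip (b - u') (b - u')) / 2)).
  have psi_cvg : (fun k => psi (x k) (u k)) @ \oo --> psi xl ul.
    have axP : (fun k => a - x k) @ \oo --> a - xl.
      by apply: cvgB => //; exact: cvg_cst.
    have buP : (fun k => b - u k) @ \oo --> b - ul.
      by apply: cvgB => //; exact: cvg_cst.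
    apply: cvgM; first exact: cvg_cst.
    apply: cvgD.
      apply: cvgD; last by apply: cvgD; exact: cvg_ip.
      by apply: cvgB; [exact: cvg_cst|exact: cvg_ip].
    apply: cvgM; first exact: cvg_cst.
    by apply: cvgM; [apply: cvgD; exact: cvg_ip | exact: cvg_cst].
  have psi_ge k : - k.+1%:R^-1 <= psi (x k) (u k).
    have [Sk gk] := zm k.
    have s01 : 0 <= s <= 1 by rewrite s1 ltW.
    have /gm := S_conv _ _ s Sk (S_graph _ _ Aab) s01.
    have : 0 <= s * (t k - ip (x k) (u k)).
      by rewrite mulr_ge0 ?subr_ge0 ?(ltW s0) //; exact: (S_ge_ip _ Sk).
    move: gk; rewrite /g /= -/(x k) -/(u k) -/(t k) /psi.
    move: (k.+1%:R^-1) => dk.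
    rewrite !ipE (ipC a (x k)) (ipC b (u k)); nra.
  have N_cvg : (fun k : nat => - k.+1%:R^-1 : R) @ \oo --> (- 0 : R).
    by apply: cvgN; exact: cvg_harmonic.
  rewrite -oppr0.
  apply: (ler_cvg_to N_cvg psi_cvg); exact: nearW.
(* [<-ul - a, -xl - b>] is the quantity in [opt] plus [|xl + ul|^2]. At [(a, b) = (-ul, -xl)] it
   vanishes, which forces [xl + ul = 0]. *)
have Aneg : A (- ul) (- xl).
  apply: maxi => a b /opt; have := ip_ge0 (xl + ul).
  rewrite !ipE (ipC ul xl) (ipC a xl); lra.
have xu0 : xl + ul = 0.
  apply: ip_le0_eq0; have := opt _ _ Aneg.
  rewrite !ipE (ipC ul xl); lra.
have xlE : - ul = xl by apply/eqP; rewrite eqr_oppLR -addr_eq0 addrC xu0.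
by exists xl; rewrite xlE in Aneg.
Qed.

(** The minimizer [p] of [|y|^2 - 2 phi y] satisfies [<p, w> - phi w >= 0] for every [w]; using [w]
    and [-w] gives equality. *)
Lemma riesz_representation (phi : X -> R) (M : R) :
  (forall a x y, phi (a *: x + y) = a * phi x + phi y) ->
  (forall x, phi x <= M * `|x|) ->
  exists p, forall y, phi y = ip p y.
Proof.
move=> lin bnd.
have phi0 : phi 0 = 0.
  by have := lin 1 0 0; rewrite scaler0 addr0; lra.
have phiZ a x : phi (a *: x) = a * phi x.
  by have := lin a x 0; rewrite addr0 phi0 addr0.
have phiD x y : phi (x + y) = phi x + phi y.
  by have := lin 1 x y; rewrite scale1r mul1r.
pose g y := ip y y - 2 * phi y.
have g_ge y : setT y -> - M ^+ 2 <= g y.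
  by move=> _; rewrite /g -sqr_norm; have := bnd y; have := sqr_ge0 (`|y| - M); nra.
have [m [u [gm um]]] := minimizing_seq (ex_intro _ (0 : X) I) g_ge.
have /cvg_ex [/= p uP] : cvg (u @ \oo).
  apply: (@cvg_minimizing _ 2) => i j.
  have [_ gi] := um i; have [_ gj] := um j.
  have := gm (2^-1 *: (u i + u j)) I.
  move: gi gj; rewrite /g phiZ phiD sqr_norm !ipE (ipC (u j) (u i)).
  move: (i.+1%:R^-1) (j.+1%:R^-1) => di dj; lra.
have opt w (s : R) : 0 <= s * (ip p w - phi w) * 2 + s ^+ 2 * ip w w.
  pose psi v := s * (ip v w - phi w) * 2 + s ^+ 2 * ip w w.
  have psi_cvg : (fun k => psi (u k)) @ \oo --> psi p.
    apply: cvgD; last exact: cvg_cst.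
    apply: cvgM; last exact: cvg_cst.
    apply: cvgM; first exact: cvg_cst.
    by apply: cvgB; [apply: cvg_ip => //; exact: cvg_cst|exact: cvg_cst].
  have psi_ge k : - k.+1%:R^-1 <= psi (u k).
    have [_ gk] := um k; have := gm (u k + s *: w) I.
    move: gk; rewrite /g /psi phiD phiZ !ipE (ipC w (u k)).
    move: (k.+1%:R^-1) => dk; nra.
  have N_cvg : (fun k : nat => - k.+1%:R^-1 : R) @ \oo --> (- 0 : R).
    by apply: cvgN; exact: cvg_harmonic.
  rewrite -oppr0; apply: (ler_cvg_to N_cvg psi_cvg); exact: nearW.
have half w : 0 <= ip p w - phi w.
  rewrite -(pmulr_lge0 _ (ltr0n R 2)).
  apply: (@ge0_linear_at0 _ _ (ip w w)) => s /andP[s0 _].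
  by rewrite -(pmulr_rge0 _ s0); have := opt w s; nra.
exists p => y; have := half y; have := half (- y).
by rewrite -scaleN1r phiZ ipZr; lra.
Qed.

(** Compactness of [[-M, M]] gives a cluster point, and an ultrafilter converges to its cluster
    points. *)
Lemma ultra_real_cvg (U : set_system nat) (f : nat -> R) (M : R) :
  UltraFilter U -> (forall n, `|f n| <= M) -> exists l : R, f @ U --> l.
Proof.
move=> UU fM.
have [|l [_ fl]] := @segment_compact R (- M) M (f @ U) _.
  rewrite /nbhs /=; apply: filterE => n /=; by rewrite in_itv /= -ler_norml.
exists l => V Vl.
have [//|nV] := in_ultra_setVsetC (f @^-1` V) UU.
by have [z []] := fl (~` V) V nV Vl.
Qed.

(** The limits of [<x n, y>] depend linearly and boundedly on [y], so Riesz represents them by a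
    vector. *)
Lemma ultra_weak_cvg (U : set_system nat) (x : nat -> X) (M : R) :
  UltraFilter U -> (forall n, `|x n| <= M) ->
  exists p, forall y, (fun n => ip (x n) y) @ U --> ip p y.
Proof.
move=> UU xM.
have ipM n y : `|ip (x n) y| <= M * `|y|.
  by rewrite (le_trans (ip_le_norm _ _)) // ler_wpM2r.
have /choice [phi phiP] y : exists l : R, (fun n => ip (x n) y) @ U --> l.
  exact: (ultra_real_cvg _ (fun n => ipM n y)).
have lin a y z : phi (a *: y + z) = a * phi y + phi z.
  apply: (cvg_unique (@norm_hausdorff R R) (phiP _)).
  rewrite (_ : (fun n => _) = fun n => a * ip (x n) y + ip (x n) z); last first.
    by apply/funext => n; rewrite ipDr ipZr.
  by apply: cvgD => //; apply: cvgM => //; exact: cvg_cst.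
have bnd y : phi y <= M * `|y|.
  apply: (ler_cvg_to (phiP y) (cvg_cst _)); apply: nearW => n.
  by rewrite (le_trans (ler_norm _)).
by have [p pP] := riesz_representation lin bnd; exists p => y; rewrite -pP.
Qed.

(* Opial's argument: the distances to two weak limits [p] and [q] along
   ultrafilters converge, so <x_n, p - q> converges, and p = q. *)
Lemma opial (x : nat -> X) (Z : set X) (M : R) :
  (forall n, `|x n| <= M) ->
  (forall U p, UltraFilter U -> \oo `<=` U ->
    (forall y, (fun n => ip (x n) y) @ U --> ip p y) -> Z p) ->
  (forall z, Z z -> cvg ((fun n => `|x n - z| ^+ 2) @ \oo)) ->
  exists p, Z p /\ weak_cvg ip x p.
Proof.
move=> xM ZU Zcvg.
have [U [UU ooU]] := ultraFilterLemma eventually_filter.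
have [p pU] := ultra_weak_cvg UU xM.
have Zp := ZU _ _ UU ooU pU.
exists p; split => // y V Vp.
apply: contrapT => nV; have {}nV : ~ \oo [set n | V (ip (x n) y)] by [].
(* [F] is generated by the tails and the indices where [<x n, y>] lies outside [V]; it is proper
   because [V] fails infinitely often. *)
pose F := [set A : set nat | \oo [set n | ~ V (ip (x n) y) -> A n]].
have ooF : Filter \oo by exact: eventually_filter.
have F_filter : Filter F.
  split.
  - by apply: (@filterE _ \oo ooF).
  - move=> A A' FA FA'.
    by apply: (@filterS2 _ \oo ooF _ _ _ _ FA FA') => n An A'n nVn; split; auto.
  - move=> A A' AA' FA.
    by apply: (@filterS _ \oo ooF _ _ _ FA) => n An nVn; apply: AA'; auto.
have F_proper : ProperFilter F.
  apply: (@Build_ProperFilter_ex _ F _ F_filter).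
  move=> A FA; apply: contrapT => nA; apply: nV.
  apply: (@filterS _ \oo ooF _ _ _ FA) => n nA'; apply: contrapT => /nA' An.
  by apply: nA; exists n.
have [W [WW FW]] := ultraFilterLemma F_proper.
have ooW : \oo `<=` W by move=> A ooA; apply: FW; rewrite /F /=; apply: (@filterS _ \oo ooF _ _ _ ooA) => n An _.
have [q qW] := ultra_weak_cvg WW xM.
have Zq := ZU _ _ WW ooW qW.
have /cvg_ex[/= lp lpP] := Zcvg _ Zp.
have /cvg_ex[/= lq lqP] := Zcvg _ Zq.
have pqE n : ip (x n) (p - q) =
    2^-1 * (`|x n - q| ^+ 2 - `|x n - p| ^+ 2 + (ip p p - ip q q)).
  by rewrite !sqr_norm !ipE (ipC q) (ipC p (x n)); field.
pose c := 2^-1 * (lq - lp + (ip p p - ip q q)).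
have pq_cvg : (fun n => ip (x n) (p - q)) @ \oo --> c.
  rewrite (funext pqE).
  apply: cvgM; first exact: cvg_cst.
  by apply: cvgD; [exact: cvgB|exact: cvg_cst].
have pE : ip p (p - q) = c.
  apply: (cvg_unique (@norm_hausdorff R R) (pU (p - q))).
  exact: (cvg_trans (cvg_app _ ooU) pq_cvg).
have qE : ip q (p - q) = c.
  apply: (cvg_unique (@norm_hausdorff R R) (qW (p - q))).
  exact: (cvg_trans (cvg_app _ ooW) pq_cvg).
have pq : p = q.
  by apply/eqP; rewrite -subr_eq0; apply/eqP/ip_le0_eq0; rewrite ipDl ipNl pE qE subrr.
have WV : W [set n | V (ip (x n) y)] by apply: (qW y V); rewrite -pq.
have WnV : W [set n | ~ V (ip (x n) y)] by apply: FW; apply: (@filterE _ \oo ooF) => n /=.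
by have [n []] := filter_ex (filterI WV WnV).
Qed.

(** * Resolvents and averaged operators *)

Lemma ip_ext x y : (forall w, ip x w = ip y w) -> x = y.
Proof.
move=> xy; apply/eqP; rewrite -subr_eq0; apply/eqP/ip_le0_eq0.
by rewrite ipDl ipNl xy subrr.
Qed.

(** Adding the point [(x, u)] to the graph keeps it [beta]-monotone, so maximality absorbs it. *)
Lemma max_beta_monotone_mem (beta : R) (B : X -> set X) x u :
  max_beta_monotone ip beta B ->
  (forall a b, B a b -> beta * `|x - a| ^+ 2 <= ip (x - a) (u - b)) -> B x u.
Proof.
move=> [mon maxi] xuB.
apply: (maxi (fun a => [set b | B a b \/ (a = x /\ b = u)])); last 2 first.
- by move=> a b Bab; left.
- by right.
move=> a b c d [Bab|[-> ->]] [Bcd|[-> ->]].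
- exact: mon.
- by have := xuB _ _ Bab; rewrite -normrN opprB -(opprB x) -(opprB u) ipNl ipNr opprK.
- exact: xuB.
- by rewrite !subrr normr0 expr0n mulr0 ip0l.
Qed.

(* [p + gamma u = y] with [u \in B p] is [p + l (u - beta p) = y / (1 + gamma beta)]
   for [l = gamma / (1 + gamma beta)], and [B - beta Id] is maximally monotone. *)
Lemma scale_op_surj (beta gamma : R) (B : X -> set X) y :
  0 <= beta -> 0 < gamma -> max_beta_monotone ip beta B ->
  exists p, scale_op gamma B p (y - p).
Proof.
move=> beta0 gamma0 maxB.
have k0 : 0 < 1 + gamma * beta by rewrite ltr_wpDr ?mulr_ge0 // ltW.
set k := 1 + gamma * beta in k0 *.
have kn0 : k != 0 by rewrite gt_eqF.
have gn0 : gamma != 0 by rewrite gt_eqF.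
pose l := gamma / k; have l0 : 0 < l by rewrite divr_gt0.
(* The shift by [k^-1 *: y] turns the equation to solve into [- q \in A q], the form given by
   [minty]. *)
pose A q := [set l *: (u - beta *: q) - k^-1 *: y | u in B q].
have [q [u Bqu qE]] : exists q, A q (- q).
  apply: minty => [a _ b _ [u Bau <-] [v Bbv <-]|x w xwA].
    have := maxB.1 _ _ _ _ Bau Bbv; rewrite -subr_ge0 => H.
    rewrite (_ : ip _ _ = l * (ip (a - b) (u - v) - beta * `|a - b| ^+ 2)).
      by rewrite mulr_ge0 // ltW.
    by rewrite sqr_norm !ipE; ring.
  (* Solves [w = l (u - beta x) - y / k] for [u]. *)
  exists (l^-1 *: (w + k^-1 *: y) + beta *: x); last first.
    by rewrite addrK scalerA divff ?gt_eqF // scale1r addrK.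
  apply: (max_beta_monotone_mem maxB) => a b Bab.
  rewrite -subr_ge0 -(pmulr_rge0 _ l0).
  rewrite (_ : l * _ = ip (x - a) (w - (l *: (b - beta *: a) - k^-1 *: y))).
    by apply: xwA; exists b.
  by rewrite sqr_norm !ipE; field; rewrite kn0 gt_eqF.
exists q, u => //; apply: ip_ext => v.
have := congr1 (fun x => k * ip x v) qE; rewrite !ipE /l.
rewrite (_ : k * _ = gamma * (ip u v - beta * ip q v) - ip y v); last by field.
by rewrite /k; lra.
Qed.

(** Surjectivity ensures that the default value [0] in [resolvent] is never what makes the
    choice. *)
Lemma resolvent_mem (beta gamma : R) (B : X -> set X) y :
  0 <= beta -> 0 < gamma -> max_beta_monotone ip beta B ->
  let p := resolvent (scale_op gamma B) y in scale_op gamma B p (y - p).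
Proof.
move=> beta0 gamma0 maxB /=.
have [p pP] := scale_op_surj y beta0 gamma0 maxB.
by rewrite /resolvent; case: xgetP => [q _ qP //|/(_ p)]; case.
Qed.

Lemma averaged_of_sqr_le (theta : R) (T : X -> X) : 0 < theta < 1 ->
  (forall y z, `|T y - T z| ^+ 2 <=
    `|y - z| ^+ 2 - (theta^-1 - 1) * `|(y - T y) - (z - T z)| ^+ 2) ->
  averaged theta T.
Proof.
move=> /andP[t0 t1] TT; split; first by rewrite t0.
have tn0 : theta != 0 by rewrite gt_eqF.
(* [N] is obtained by solving [T = (1 - theta) Id + theta N]. *)
exists (fun y => y - theta^-1 *: (y - T y)); split => [y z|y]; last first.
  by apply: ip_ext => w; rewrite !ipE; field.
rewrite -(@ler_pXn2r _ 2) ?nnegrE // -subr_ge0.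
have := TT y z; rewrite -subr_ge0 => H.
rewrite (_ : _ - _ = theta^-1 *  (`|y - z| ^+ 2
  - (theta^-1 - 1) * `|(y - T y) - (z - T z)| ^+ 2 - `|T y - T z| ^+ 2)).
  by rewrite mulr_ge0 // invr_ge0 ltW.
rewrite !sqr_norm !ipE (ipC z y) (ipC (T y) y) (ipC (T z) y) (ipC (T y) z).
by rewrite (ipC (T z) z) (ipC (T z) (T y)); field.
Qed.

(** * The forward-backward operator *)

Section ForwardBackward.
Variables (B : X -> set X) (C : X -> X) (beta sigma gamma eta : R).
Variables (beta0 : 0 <= beta) (maxB : max_beta_monotone ip beta B).
Variables (cocoC : cocoercive ip sigma C).
Variables (gammaP : 0 < gamma < 4 * sigma).
Variables (etaP : 0 < eta < 2 - gamma / (2 * sigma)).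

Let T := T_FB eta gamma B C.
Let J (y : X) : X := resolvent (scale_op gamma B) (y - gamma *: C y).
Let kappa := (4 * sigma - gamma) / (2 * eta * sigma) - 1.
Let mu := gamma / (2 * eta * sigma).

Let gamma0 : 0 < gamma. Proof. by case/andP: gammaP. Qed.
Let eta0 : 0 < eta. Proof. by case/andP: etaP. Qed.
Let sigma0 : 0 < sigma. Proof. by case/andP: gammaP => g0 g4; lra. Qed.
Let es0 : 0 < 2 * eta * sigma. Proof. by rewrite !mulr_gt0. Qed.

(** The bound on [eta] multiplied by [2 * sigma]; it makes [kappa] positive and the averaging
    constant less than one. *)
Let esE : 2 * eta * sigma < 4 * sigma - gamma.
Proof.
case/andP: etaP => _; rewrite -(ltr_pM2r (_ : 0 < 2 * sigma)) ?mulr_gt0 //.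
by rewrite mulrBl divfK ?gt_eqF ?mulr_gt0 //; lra.
Qed.

Lemma kappa_gt0 : 0 < kappa.
Proof. by rewrite subr_gt0 ltr_pdivlMr // mul1r. Qed.

Lemma mu_gt0 : 0 < mu.
Proof. by rewrite divr_gt0. Qed.

Lemma sub_T_FB y : y - T y = eta *: (y - J y).
Proof. by apply: ip_ext => w; rewrite /T /T_FB -/(J y) !ipE; ring. Qed.

Lemma T_FB_estimate y z :
  `|T y - T z| ^+ 2 <= `|y - z| ^+ 2
    - kappa * `|(y - T y) - (z - T z)| ^+ 2
    - mu * `|(y - T y) - (z - T z) - (2 * eta * sigma) *: (C y - C z)| ^+ 2
    - 2 * eta * gamma * beta * `|J y - J z| ^+ 2.
Proof.
have [u Bu uE] := resolvent_mem (y - gamma *: C y) beta0 gamma0 maxB.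
have [v Bv vE] := resolvent_mem (z - gamma *: C z) beta0 gamma0 maxB.
have := maxB.1 _ _ _ _ Bu Bv; rewrite -/(J y) -/(J z) in uE vE *.
have := cocoC y z.
rewrite -(ler_pM2l gamma0) => coco; rewrite -(ler_pM2l gamma0) => mon.
have {}mon : gamma * (beta * `|J y - J z| ^+ 2) <=
    ip (J y - J z) (y - z - gamma *: (C y - C z) - (J y - J z)).
  apply: (le_trans mon); rewrite -ipZr scalerBr uE vE.
  by rewrite le_eqVlt; apply/orP; left; apply/eqP; rewrite !ipE; ring.
set d := y - z in coco mon *; set c := C y - C z in coco mon *.
set e := J y - J z in mon *.
have -> : y - T y - (z - T z) = eta *: (d - e).
  by apply: ip_ext => w; rewrite !sub_T_FB /d /e !ipE; ring.
have -> : T y - T z = d - eta *: (d - e).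
  by apply: ip_ext => w; rewrite /T /T_FB -/(J y) -/(J z) /d /e !ipE; ring.
(* In terms of [d], [c], [e] alone, the gap between the two sides is exactly [2 eta] times the sum
   of the slacks of monotonicity and cocoercivity. *)
clearbody d c e; rewrite -subr_ge0 (_ : _ - _ = 2 * eta *
  ((ip e (d - gamma *: c - e) - gamma * (beta * `|e| ^+ 2))
   + (gamma * ip d c - gamma * (sigma * `|c| ^+ 2)))).
  by rewrite !mulr_ge0 ?(ltW eta0) // addr_ge0 // subr_ge0.
rewrite /kappa /mu !sqr_norm !ipE (ipC e d) (ipC c d) (ipC c e).
by field; rewrite !gt_eqF.
Qed.

Lemma T_FB_le y z : `|T y - T z| ^+ 2 <= `|y - z| ^+ 2
    - kappa * `|(y - T y) - (z - T z)| ^+ 2.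
Proof.
apply: (le_trans (T_FB_estimate y z)); rewrite -addrA gerDl -opprD oppr_le0.
apply: addr_ge0; first by apply: mulr_ge0; [exact: ltW mu_gt0|exact: sqr_ge0].
by rewrite !mulr_ge0 ?sqr_ge0 // ltW.
Qed.

Lemma T_FB_nonexpansive : nonexpansive T.
Proof.
move=> y z; rewrite -(@ler_pXn2r _ 2) ?nnegrE //.
rewrite (le_trans (T_FB_le y z)) // gerBl.
by apply: mulr_ge0; [exact: ltW kappa_gt0|exact: sqr_ge0].
Qed.

Lemma T_FB_averaged : averaged (2 * eta * sigma / (4 * sigma - gamma)) T.
Proof.
have den0 : 0 < 4 * sigma - gamma by exact: lt_trans esE.
apply: averaged_of_sqr_le => [|y z]; last by rewrite invf_div T_FB_le.
by rewrite divr_gt0 // ltr_pdivrMr // mul1r.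
Qed.

Lemma zer_T_FB y : zer (add_op B C) y <-> T y = y.
Proof.
have TyE : T y = y <-> J y = y.
  split=> [Ty|Jy]; last by rewrite -[LHS](subKr y) sub_T_FB Jy subrr scaler0 subr0.
  have /eqP := sub_T_FB y; rewrite Ty subrr eq_sym scaler_eq0 gt_eqF //=.
  by rewrite subr_eq0 => /eqP.
rewrite TyE; have := resolvent_mem (y - gamma *: C y) beta0 gamma0 maxB.
rewrite -/(J y) => -[u Bu uE]; split=> [[v Bv vC0]|Jy].
  have vE : v = - C y by apply/eqP; rewrite -addr_eq0 vC0.
  (* Since [gamma (u - v) = y - J y], monotonicity at [J y] and [y] reads [0 <= - |J y - y|^2]. *)
  have := maxB.1 _ _ _ _ Bu Bv; rewrite -(ler_pM2l gamma0) => mon.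
  apply/eqP; rewrite -subr_eq0; apply/eqP/ip_le0_eq0.
  have : 0 <= gamma * (beta * `|J y - y| ^+ 2) by rewrite !mulr_ge0 // ltW.
  move=> /le_trans /(_ mon); rewrite -ipZr scalerBr uE vE.
  by rewrite !ipE (ipC y (J y)); lra.
exists u; first by rewrite -Jy.
have guC : gamma *: (u + C y) = 0.
  by rewrite scalerDr uE Jy; apply: ip_ext => w; rewrite !ipE ip0l; ring.
by move/eqP: guC; rewrite scaler_eq0 gt_eqF //= => /eqP.
Qed.

(** * Convergence of the iterates relative to a fixed zero *)

Section Iteration.
Variables (x : nat -> X) (xS : forall n, x n.+1 = T (x n)).
Variables (z : X) (zP : zer (add_op B C) z).

Let Tz : T z = z. Proof. exact/zer_T_FB. Qed.
Let Jz : J z = z.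
Proof.
have /eqP := sub_T_FB z; rewrite Tz subrr eq_sym scaler_eq0 gt_eqF //=.
by rewrite subr_eq0 => /eqP.
Qed.

Lemma fejer n : `|x n.+1 - z| ^+ 2 <= `|x n - z| ^+ 2
    - kappa * `|x n - T (x n)| ^+ 2
    - mu * `|x n - T (x n) - (2 * eta * sigma) *: (C (x n) - C z)| ^+ 2
    - 2 * eta * gamma * beta * `|J (x n) - z| ^+ 2.
Proof.
by have := T_FB_estimate (x n) z; rewrite -xS Tz Jz subrr subr0.
Qed.

Let K0 n : 0 <= kappa * `|x n - T (x n)| ^+ 2.
Proof. by apply: mulr_ge0; [exact: ltW kappa_gt0|exact: sqr_ge0]. Qed.
Let M0 n : 0 <= mu * `|x n - T (x n) - (2 * eta * sigma) *: (C (x n) - C z)| ^+ 2.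
Proof. by apply: mulr_ge0; [exact: ltW mu_gt0|exact: sqr_ge0]. Qed.
Let B0 n : 0 <= 2 * eta * gamma * beta * `|J (x n) - z| ^+ 2.
Proof. by rewrite !mulr_ge0 ?sqr_ge0 // ltW. Qed.

Lemma fejer_cvg : cvg ((fun n => `|x n - z| ^+ 2) @ \oo).
Proof.
apply: nonincreasing_is_cvgn.
  apply/nonincreasing_seqP => n; apply: (le_trans (fejer n)).
  by have := K0 n; have := M0 n; have := B0 n; lra.
by exists 0 => _ [n _ <-]; exact: sqr_ge0.
Qed.

Lemma iter_bounded n : `|x n| <= `|x 0%N - z| + `|z|.
Proof.
rewrite -{1}(subrK z (x n)) (le_trans (ler_normD _ _)) // lerD2r.
elim: n => // n; apply: le_trans.
by rewrite xS -{1}Tz T_FB_nonexpansive.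
Qed.

Lemma residual_sqr n : `|x n.+1 - z| ^+ 2 <=
  `|x n - z| ^+ 2 - kappa * `|x n - T (x n)| ^+ 2.
Proof. by have := fejer n; have := M0 n; have := B0 n; lra. Qed.

Lemma residual_cvg : (fun n => x n - T (x n)) @ \oo --> 0.
Proof.
apply: cvg0_of_sqr; apply: (cvg0_of_telescope kappa_gt0 _ fejer_cvg residual_sqr).
by move=> n; exact: sqr_ge0.
Qed.

Lemma residual_rate :
  (fun n => Num.sqrt n%:R * `|x n - T (x n)|) @ \oo --> (0 : R).
Proof.
apply: cvg0_of_sqr.
rewrite (_ : (fun n => _) = fun n => n%:R * `|x n - T (x n)| ^+ 2); last first.
  apply/funext => n; rewrite ger0_norm ?mulr_ge0 ?sqrtr_ge0 //.
  by rewrite exprMn sqr_sqrtr.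
apply: (cvg0_natmul kappa_gt0 _ _ fejer_cvg residual_sqr) => n.
  exact: sqr_ge0.
(* Residuals decrease: the next one is the difference of the [T]-images of [x n] and [x n.+1]. *)
by rewrite ler_pXn2r ?nnegrE // -xS (xS n.+1) (xS n) T_FB_nonexpansive.
Qed.

(** The [mu] term of [fejer] tends to zero; so does the residual, hence also their difference
    [2 eta sigma (C (x n) - C z)]. *)
Lemma forward_cvg : (fun n => C (x n)) @ \oo --> C z.
Proof.
have vP : (fun n => x n - T (x n) - (2 * eta * sigma) *: (C (x n) - C z)) @ \oo --> 0.
  apply: cvg0_of_sqr; apply: (cvg0_of_telescope mu_gt0 _ fejer_cvg).
    by move=> n; exact: sqr_ge0.
  by move=> n; have := fejer n; have := K0 n; have := B0 n; lra.
have -> : (fun n => C (x n)) = (fun n => (2 * eta * sigma)^-1 *: (x n - T (x n)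
    - (x n - T (x n) - (2 * eta * sigma) *: (C (x n) - C z))) + C z).
  apply/funext => n; rewrite subKr scalerA mulVf ?gt_eqF // scale1r.
  by rewrite subrK.
suff : (fun n => (2 * eta * sigma)^-1 *: (x n - T (x n)
    - (x n - T (x n) - (2 * eta * sigma) *: (C (x n) - C z))) + C z) @ \oo -->
    (2 * eta * sigma)^-1 *: (0 - 0 : X) + C z by rewrite subr0 scaler0 add0r.
apply: cvgD; last exact: cvg_cst.
by apply: cvgZr; apply: cvgB => //; exact: residual_cvg.
Qed.

(** The [beta] term of [fejer] gives [J (x n) --> z], and [x n - J (x n)] is [eta^-1] times the
    residual. *)
Lemma strong_cvg : 0 < beta -> x @ \oo --> z.
Proof.
move=> b0.
have c0 : 0 < 2 * eta * gamma * beta by rewrite !mulr_gt0.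
have pP : (fun n => J (x n) - z) @ \oo --> 0.
  apply: cvg0_of_sqr; apply: (cvg0_of_telescope c0 _ fejer_cvg).
    by move=> n; exact: sqr_ge0.
  by move=> n; have := fejer n; have := K0 n; have := M0 n; lra.
have -> : x = (fun n => eta^-1 *: (x n - T (x n)) + (J (x n) - z) + z).
  apply/funext => n; rewrite sub_T_FB scalerA mulVf ?gt_eqF // scale1r.
  by rewrite addrA !subrK.
suff : (fun n => eta^-1 *: (x n - T (x n)) + (J (x n) - z) + z) @ \oo -->
    eta^-1 *: (0 : X) + 0 + z by rewrite scaler0 !add0r.
apply: cvgD; last exact: cvg_cst.
by apply: cvgD => //; apply: cvgZr; exact: residual_cvg.
Qed.

(* Monotonicity of [Id - T], in the strong form
   [|w|^2 <= 2 <d, w>] where [d] and [w] are the differences of the points and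
   of their residuals, makes [Id - T] demiclosed. *)
Lemma weak_limit_zer U p : UltraFilter U -> \oo `<=` U ->
  (forall y, (fun n => ip (x n) y) @ U --> ip p y) -> zer (add_op B C) p.
Proof.
move=> UU ooU xp; apply/zer_T_FB.
have wU : (fun n => x n - T (x n)) @ U --> 0.
  exact: cvg_trans (cvg_app _ ooU) residual_cvg.
have [q qE] : exists q, q = p - T p by exists (p - T p).
have le n : `|x n - T (x n) - q| ^+ 2 <=
    2 * (ip (x n - p) (x n - T (x n)) - (ip (x n) q - ip p q)).
  have := T_FB_le (x n) p; rewrite -qE.
  have -> : T (x n) - T p = (x n - p) - (x n - T (x n) - q).
    by apply: ip_ext => w; rewrite qE !ipE; ring.
  have : 0 <= kappa * `|x n - T (x n) - q| ^+ 2.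
    by apply: mulr_ge0; [exact: ltW kappa_gt0|exact: sqr_ge0].
  have -> : ip (x n) q - ip p q = ip (x n - p) q by rewrite ipDl ipNl.
  move: (x n - T (x n)) (x n - p) => w d; rewrite !sqr_norm !ipE.
  by rewrite (ipC q w) (ipC w d) (ipC q d); lra.
(* A bounded factor times a strongly null one. *)
have crossU : (fun n => ip (x n - p) (x n - T (x n))) @ U --> 0.
  apply/cvgr0Pnorm_lt => e e0.
  pose M := `|x 0%N - z| + `|z| + `|p| + 1.
  have M_gt0 : 0 < M by rewrite ltr_wpDl // !addr_ge0.
  have eM0 : 0 < e / M by rewrite divr_gt0.
  have /cvgr0Pnorm_lt /(_ _ eM0) := wU; apply: filterS => n wn.
  rewrite (le_lt_trans (ip_le_norm _ _)) //.
  have xnM : `|x n - p| <= M.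
    by rewrite (le_trans (ler_normB _ _)) // /M; have := iter_bounded n; lra.
  rewrite (le_lt_trans (ler_wpM2r (normr_ge0 _) xnM)) //.
  by rewrite mulrC -ltr_pdivlMr.
have lhsU : (fun n => `|x n - T (x n) - q| ^+ 2) @ U --> `|0 - q| ^+ 2.
  by apply: cvgM; apply: cvg_norm; apply: cvgB => //; exact: cvg_cst.
have rhsU : (fun n => 2 * (ip (x n - p) (x n - T (x n)) - (ip (x n) q - ip p q)))
    @ U --> (2 * (0 - (ip p q - ip p q)) : R).
  apply: cvgM; first exact: cvg_cst.
  by apply: cvgB => //; apply: cvgB; [exact: xp|exact: cvg_cst].
have U_proper : ProperFilter U by exact: ultra_proper.
(* The limit of [le] along [U] says [|q|^2 <= 0], that is, [p = T p]. *)
have : `|0 - q| ^+ 2 <= 2 * (0 - (ip p q - ip p q)).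
  by apply: (ler_cvg_to lhsU rhsU); exact: nearW.
rewrite subrr subr0 mulr0 sub0r normrN sqr_norm => /ip_le0_eq0 /eqP.
by rewrite qE subr_eq0 eq_sym => /eqP.
Qed.

End Iteration.
End ForwardBackward.
End InnerProduct.

Theorem theorem5p1 (R : realType) (X : completeNormedModType R)
  (ip : X -> X -> R) (B : X -> set X) (C : X -> X)
  (beta sigma gamma eta : R) (x0 : X) :
  inner_product ip ->
  0 <= beta -> max_beta_monotone ip beta B ->
  cocoercive ip sigma C ->
  0 < gamma < 4 * sigma ->
  0 < eta < 2 - gamma / (2 * sigma) ->
  let T := T_FB eta gamma B C in
  let x := fun n : nat => iter n T x0 in
  (* (i) *)
  ((forall y z : X,
     `|T y - T z| ^+ 2 <=
       `|y - z| ^+ 2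
       - ((4 * sigma - gamma) / (2 * eta * sigma) - 1)
           * `|(y - T y) - (z - T z)| ^+ 2
       - gamma / (2 * eta * sigma)
           * `|(y - T y) - (z - T z) - (2 * eta * sigma) *: (C y - C z)| ^+ 2)
   /\ averaged (2 * eta * sigma / (4 * sigma - gamma)) T)
  /\
  (* (ii) *)
  (zer (add_op B C) !=set0 ->
   exists xs : X,
     zer (add_op B C) xs /\
     (fun n : nat => Num.sqrt (n%:R) * `|x n - T (x n)|) @ \oo --> (0 : R) /\
     weak_cvg ip x xs /\
     (fun n => C (x n)) @ \oo --> C xs /\
     C @` zer (add_op B C) = [set C xs] /\
     (0 < beta -> x @ \oo --> xs /\ zer (add_op B C) = [set xs])).
Proof.
move=> ip_inner beta0 maxB cocoC gammaP etaP T x.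
have xS n : x n.+1 = T (x n) by [].
split.
  split; last exact: (T_FB_averaged ip_inner beta0 maxB cocoC gammaP etaP).
  move=> y z.
  apply: (le_trans (T_FB_estimate ip_inner beta0 maxB cocoC gammaP etaP y z)).
  case/andP: etaP => eta0 _; case/andP: gammaP => gamma0 _.
  by rewrite gerBl !mulr_ge0 ?sqr_ge0 // ltW.
move=> [z zP].
(* These facts hold at every zero, so uniqueness of limits makes [C] constant on the zeros and, when
   [beta > 0], the zero unique. *)
pose zero_facts y (yP : zer (add_op B C) y) :=
  (forward_cvg ip_inner beta0 maxB cocoC gammaP etaP xS yP,
   fejer_cvg ip_inner beta0 maxB cocoC gammaP etaP xS yP,
   strong_cvg ip_inner beta0 maxB cocoC gammaP etaP xS yP).
have [xs [xsP x_weak]] : exists xs, zer (add_op B C) xs /\ weak_cvg ip x xs.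
  apply: (opial ip_inner
    (iter_bounded ip_inner beta0 maxB cocoC gammaP etaP xS zP)).
  - exact: (weak_limit_zer ip_inner beta0 maxB cocoC gammaP etaP xS zP).
  - by move=> y yP; have [[]] := zero_facts y yP.
have [[C_cvg _] x_cvg] := zero_facts xs xsP.
exists xs; split=> //; split.
  exact: (residual_rate ip_inner beta0 maxB cocoC gammaP etaP xS zP).
split=> //; split=> //; split.
  apply/seteqP; split=> [_ [y yP <-]|_ ->]; last by exists xs.
  have [[Cy_cvg _] _] := zero_facts y yP.
  exact: (cvg_unique (@norm_hausdorff R X) Cy_cvg C_cvg).
move=> b0; split; first exact: x_cvg.
apply/seteqP; split=> [y yP|_ ->//].
have [_ y_cvg] := zero_facts y yP.
exact: (cvg_unique (@norm_hausdorff R X) (y_cvg b0) (x_cvg b0)).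
Qed.
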